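(* Let $(X,\|\cdot\|)$ be an AM-space with unit, let $G$ be an open subset of $X$ and let $F:G\to X$ be a nonexpansive map with respect to $\|\cdot\|$ (i.e. $\|F(x)-F(y)\|\le\|x-y\|$ for all $x,y\in G$). Let $v\in G$ be a fixed point of $F$: $F(v)=v$. Assume: (A1) $F$ is semidifferentiable at $v$, with semidifferential $F'_v:X\to X$; (A2) the map $\mathrm{Id}-F'_v:X\to X$ has Property (F); (A3) the fixed point of $F'_v:X\to X$ is unique: if $x\in X$ and $F'_v(x)=x$, then $x=0$. Then the fixed point of $F$ in $G$ is unique: if $w\in G$ and $F(w)=w$, then $w=v$.
   Context: AM-space with unit: a (real) Banach lattice $(X,\|\cdot\|,\le)$ equipped with a distinguished element $e\ge0$ (the unit) such that $\|x\|=\inf\{a\ge0\mid -ae\le x\le ae\}$ for all $x\in X$ (equivalently, up to isometric lattice isomorphism, $X=\mathscr C(K)$ with the sup-norm for a compact Hausdorff space $K$, with $e$ the constant function $1$). Semidifferentiability: let $G\subset X$ and $v$ an interior point of $G$. A map $F:G\to X$ is semidifferentiable at $v$ if there exists a continuous, positively homogeneous map $h:X\to X$ (i.e. $h(tx)=th(x)$ for all $t>0$, $x\in X$) such that $F(v+x)=F(v)+h(x)+o(\|x\|)$ as $x\to0$. Such $h$ is unique and denoted $F'_v$ (the semidifferential of $F$ at $v$). Property (F): a map $g:D\to Y$, with $D\subset X$ and $X,Y$ Banach spaces, has Property (F) if every sequence $(x_j)_{j\ge1}$ in $D$ that is bounded in $X$ and satisfies $g(x_j)\to0$ has a subsequence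 that converges in $X$. *)

(* Defs.v *)
From HB Require Import structures.
From mathcomp Require Import all_boot all_order all_algebra.
From mathcomp Require Import all_classical all_reals all_analysis.
Set Implicit Arguments.
Unset Strict Implicit.
Unset Printing Implicit Defensive.
Import Order.TTheory GRing.Theory Num.Theory.
Import numFieldNormedType.Exports.
Local Open Scope classical_set_scope.
Local Open Scope ring_scope.

(* The order is carried by the mixin: the order structures of MathComp cannot be
   joined a posteriori with complete normed modules.  The modulus of x in the
   lattice is the join of x and - x; `|x| denotes the norm. *)
HB.mixin Record isBanachLattice (R : realType) X
    of CompleteNormedModule R X := {
  lat_le : rel X ;
  lat_join : X -> X -> X ;
  lat_meet : X -> X -> X ;
  lat_le_refl : reflexive lat_le ;
  lat_le_anti : antisymmetric lat_le ;
  lat_le_trans : transitive lat_le ;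
  lat_joinP : forall x y z : X,
    lat_le (lat_join x y) z = lat_le x z && lat_le y z ;
  lat_meetP : forall x y z : X,
    lat_le z (lat_meet x y) = lat_le z x && lat_le z y ;
  lat_leD2r : forall x y z : X, lat_le x y -> lat_le (x + z) (y + z) ;
  lat_leZ : forall (a : R) (x y : X),
    0 <= a -> lat_le x y -> lat_le (a *: x) (a *: y) ;
  lat_le_norm : forall x y : X,
    lat_le (lat_join x (- x)) (lat_join y (- y)) -> `|x| <= `|y|
}.

#[short(type="banachLatticeType")]
HB.structure Definition BanachLattice (R : realType) :=
  { X of CompleteNormedModule R X & isBanachLattice R X }.

(* inf set0 = 0 in the library. This convention is harmless here: if the set is
   empty for some x then x has norm 0, hence x = 0, and 0 belongs to the set. *)
HB.mixin Record isAMSpaceWithUnit (R : realType) X of BanachLattice R X := {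
  am_unit : X ;
  am_unit_ge0 : lat_le 0 am_unit ;
  am_unit_norm : forall x : X,
    `|x| = inf [set a : R | [/\ 0 <= a, lat_le (- (a *: am_unit)) x &
                                lat_le x (a *: am_unit)]]
}.

#[short(type="amSpaceType")]
HB.structure Definition AMSpaceWithUnit (R : realType) :=
  { X of BanachLattice R X & isAMSpaceWithUnit R X }.

(* A map G -> Y with G : set X is represented by a total function on X whose
   values outside of G are irrelevant. *)
Definition nonexpansive_on (R : realType) (X Y : normedModType R)
    (G : set X) (F : X -> Y) : Prop :=
  forall x y, G x -> G y -> `|F x - F y| <= `|x - y|.

Definition positively_homogeneous (R : realType) (X Y : normedModType R)
    (h : X -> Y) : Prop :=
  forall (t : R) (x : X), 0 < t -> h (t *: x) = t *: h x.

(* h is the semidifferential at v of F : G -> Y. *)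
Definition is_semidifferential (R : realType) (X Y : normedModType R)
    (G : set X) (F : X -> Y) (v : X) (h : X -> Y) : Prop :=
  [/\ interior G v, continuous h, positively_homogeneous h &
      (fun x => F (v + x) - (F v + h x)) =o_ (0 : X) id].

Definition property_F (R : realType) (X Y : completeNormedModType R)
    (D : set X) (g : X -> Y) : Prop :=
  forall x_ : nat -> X,
    (forall j, D (x_ j)) -> bounded_fun x_ -> g \o x_ @ \oo --> (0 : Y) ->
    exists2 phi : nat -> nat, increasing_seq phi & cvgn (x_ \o phi).

(* Main.v *)
Require Import Defs.
From mathcomp Require Import all_boot all_order all_algebra.
From mathcomp Require Import all_classical all_reals all_analysis.
From mathcomp Require Import lra.
Set Implicit Arguments.
Unset Strict Implicit.
Unset Printing Implicit Defensive.
Import Order.TTheory GRing.Theory Num.Theory.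
Import numFieldNormedType.Exports.
Local Open Scope classical_set_scope.
Local Open Scope ring_scope.

(** If [w] were another fixed point, at distance [d] from [v], then for small
[r] the set [{x | `|x - v| <= r, `|x - w| <= d - r}] would be convex, invariant
under [F], nonempty, and contained in the sphere of radius [r] around [v].  A
nonexpansive self-map of a bounded convex set has approximate fixed points;
rescaling those to the unit sphere as [r] tends to 0 gives unit vectors [u] with
[u - F'_v u] arbitrarily small.  Property (F) then yields a unit fixed point of
[F'_v]. *)

(* The Picard iterates of the strict contraction [t x0 + (1 - t) F x] are
asymptotically regular: consecutive ones differ by at most [(1 - t) ^+ k * M]. *)
Lemma nonexpansive_approx_fixpoint (R : realType) (V : normedModType R)
    (C : set V) (F : V -> V) (x0 : V) (M : R) :
    C x0 ->
    (forall x y (t : R), C x -> C y -> 0 <= t <= 1 ->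
      C (t *: x + (1 - t) *: y)) ->
    (forall x y, C x -> C y -> `|x - y| <= M) ->
    (forall x, C x -> C (F x)) -> nonexpansive_on C F ->
  forall e : R, 0 < e -> exists2 x, C x & `|x - F x| <= e.
Proof.
move=> Cx0 Cconv CM CF Fne e e0.
have M0 : 0 <= M by rewrite (le_trans _ (CM _ _ Cx0 Cx0)).
(* This makes [t * M] at most [e / 2]; the summand [e] in the denominator keeps it positive when
   [M = 0]. *)
pose t := e / (2 * M + e).
have den0 : 0 < 2 * M + e by lra.
have t0 : 0 < t by rewrite divr_gt0.
have t1 : t <= 1 by rewrite ler_pdivrMr //; lra.
have tM : t * M <= e / 2.
  rewrite /t -mulrA [_^-1 * M]mulrC mulrA ler_pdivrMr //; nra.
pose g x := t *: x0 + (1 - t) *: F x.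
have Cg x : C x -> C (g x).
  by move=> Cx; apply: Cconv => //; [exact: CF|rewrite (ltW t0)].
pose y k := iter k g x0.
have Cy k : C (y k) by elim: k => //= k; exact: Cg.
have ystep k : `|y k - y k.+1| <= (1 - t) ^+ k * M.
  elim: k => [|k IH]; first by rewrite expr0 mul1r; apply: CM => //; exact: Cy.
  rewrite [y k.+2]/(g (y k.+1)) {1}[y k.+1]/(g (y k)) /g opprD addrACA subrr.
  rewrite add0r -scalerBr normrZ ger0_norm ?subr_ge0// exprS -mulrA.
  by rewrite ler_wpM2l ?subr_ge0// (le_trans (Fne _ _ (Cy _) (Cy _))).
have [k kM] : exists k, (1 - t) ^+ k * M <= e / 2.
  have : `|1 - t| < 1 by rewrite ger0_norm; lra.
  move=> /(cvg_geometric M) /cvgrPdist_le /(_ (e / 2)) [|k _ /(_ k (leqnn k))].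
    lra.
  rewrite /= sub0r normrN mulrC => /(le_trans (ler_norm _)) ?; by exists k.
exists (y k) => //.
have gE : g (y k) = F (y k) + t *: (x0 - F (y k)).
  by rewrite /g scalerBl scale1r scalerBr addrCA.
(* The defect splits into a Picard step and the perturbation made by the contraction, each at most
   [e / 2]. *)
have -> : y k - F (y k) = (y k - y k.+1) + t *: (x0 - F (y k)).
  by rewrite [y k.+1]gE opprD addrA subrK.
have := le_trans (ystep k) kM.
have : `|t *: (x0 - F (y k))| <= t * M.
  by rewrite normrZ gtr0_norm// ler_pM2l//; apply: CM => //; exact: CF.
have := ler_normD (y k - y k.+1) (t *: (x0 - F (y k))).
lra.
Qed.

(** Since [F] fixes both centres, it maps the intersection of the [r]-ball around [v] and the
    complementary ball around [w] into itself. *)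
Lemma nonexpansive_approx_fixpoint_sphere (R : realType) (V : normedModType R)
    (G : set V) (F : V -> V) (v w : V) (r : R) :
    nonexpansive_on G F -> G v -> F v = v -> G w -> F w = w ->
    (forall x, `|x - v| <= r -> G x) -> 0 < r <= `|w - v| ->
  forall e : R, 0 < e -> exists2 x, `|x - v| = r & `|x - F x| <= e.
Proof.
move=> Fne Gv Fv Gw Fw rG /andP[r0 rd] e e0.
set d := `|w - v| in rd.
have d0 : 0 < d by exact: lt_le_trans rd.
pose C := [set x : V | `|x - v| <= r /\ `|x - w| <= d - r].
have CG x : C x -> G x by case=> xr _; exact: rG.
have cvx (a x y : V) (b t : R) : `|x - a| <= b -> `|y - a| <= b -> 0 <= t <= 1 ->
    `|t *: x + (1 - t) *: y - a| <= b.
  move=> xa ya /andP[t0 t1].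
  have -> : t *: x + (1 - t) *: y - a = t *: (x - a) + (1 - t) *: (y - a).
    by rewrite !scalerBr addrACA -opprD -scalerDl [t + _]addrC subrK scale1r.
  apply: le_trans (ler_normD _ _) _.
  rewrite !normrZ !ger0_norm ?subr_ge0//; nra.
(* The starting point lies on the segment from [v] to [w], at distance [r] from [v] and [d - r] from
   [w]. The diameter bound [r + r] comes from the ball around [v]. *)
have [|||||x [xr xd] xe] :=
    @nonexpansive_approx_fixpoint R V C F (v + (r / d) *: (w - v)) (r + r) _ _ _ _ _ e e0.
- have dw : d *: (d^-1 *: (w - v)) = w - v.
    by rewrite scalerA divff ?scale1r// gt_eqF.
  split.
    by rewrite addrC addKr normrZ -/d ger0_norm ?divfK ?gt_eqF// divr_ge0 ?ltW.
  have -> : v + (r / d) *: (w - v) - w = - ((1 - r / d) *: (w - v)).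
    by rewrite scalerBl scale1r opprB addrAC -(opprB w v) addrC.
  rewrite normrN normrZ -/d ger0_norm; last by rewrite subr_ge0 ler_pdivrMr ?mul1r.
  by rewrite mulrBl mul1r divfK ?gt_eqF.
- by move=> x y t [xv xw] [yv yw] t01; split; exact: cvx.
- move=> x y [xv _] [yv _]; rewrite -(subrKA v) (le_trans (ler_normD _ _))//.
  by rewrite lerD// distrC.
- move=> x Cx; case: (Cx) => xv xw; split.
    by rewrite -{1}Fv (le_trans (Fne _ _ (CG _ Cx) Gv)).
  by rewrite -{1}Fw (le_trans (Fne _ _ (CG _ Cx) Gw)).
- by move=> x y /CG Gx /CG Gy; exact: Fne.
exists x => //; apply/eqP; rewrite eq_le xr /=.
(* The two radii add up to [d], so a point strictly closer than [r] to [v] would violate the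
   triangle inequality. *)
have := ler_distD x w v; rewrite -/d distrC in xd *; lra.
Qed.

(** On the sphere of radius [r], the fixed-point defect of [F] and the little-o remainder are each
    at most [e / 2 * r]; positive homogeneity of [h] allows division by [r]. *)
Lemma semidifferential_approx_fixpoint (R : realType) (V : normedModType R)
    (G : set V) (F : V -> V) (v w : V) (h : V -> V) :
    nonexpansive_on G F -> G v -> F v = v -> G w -> F w = w -> w != v ->
    is_semidifferential G F v h ->
  forall e : R, 0 < e -> exists2 u, `|u| = 1 & `|u - h u| <= e.
Proof.
move=> Fne Gv Fv Gw Fw wv [Gint _ hhom hF] e e0.
have e20 : 0 < e / 2 by lra.
have /eqoP/(_ _ e20)/nbhs_normP[s /= s0 Fs] := hF.
have /nbhs_normP[q /= q0 Gq] := Gint.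
have d0 : 0 < `|w - v| by rewrite normr_gt0 subr_eq0.
(* Halving [s] and [q] puts the closed [r]-ball inside the open balls where the remainder estimate
   and membership in [G] hold. *)
pose r := Num.min (s / 2) (Num.min (q / 2) `|w - v|).
have r0 : 0 < r by rewrite !lt_min d0 !divr_gt0.
have [rs [rq rd]] : r <= s / 2 /\ r <= q / 2 /\ r <= `|w - v|.
  by rewrite !ge_min !lexx !orbT.
have [||x xr xe] := @nonexpansive_approx_fixpoint_sphere R V G F v w r
    Fne Gv Fv Gw Fw _ _ _ (mulr_gt0 e20 r0).
- move=> x xr; apply: Gq => /=; rewrite /ball_ /= distrC; lra.
- by rewrite r0.
exists (r^-1 *: (x - v)).
  by rewrite normrZ xr ger0_norm ?mulVf ?gt_eqF// invr_ge0 ltW.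
rewrite hhom ?invr_gt0// -scalerBr normrZ gtr0_norm ?invr_gt0//.
rewrite ler_pdivrMl//.
have /Fs /= : ball_ Num.norm 0 s (x - v).
  rewrite /ball_ /= sub0r normrN; lra.
rewrite addrCA subrr addr0 Fv xr => Fx.
have -> : x - v - h (x - v) = (x - F x) + (F x - (v + h (x - v))).
  by rewrite addrA subrK opprD addrA.
have := ler_normD (x - F x) (F x - (v + h (x - v))); lra.
Qed.

Theorem corollary10p1 (R : realType) (X : amSpaceType R) (G : set X)
    (F : X -> X) (v : X) (dF : X -> X)
    (G_open : open G)
    (F_nonexp : nonexpansive_on G F)
    (Gv : G v)
    (Fv : F v = v)
    (A1 : is_semidifferential G F v dF)
    (A2 : property_F [set: X] (fun x => x - dF x))
    (A3 : forall x : X, dF x = x -> x = 0) :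
  forall w : X, G w -> F w = w -> w = v.
Proof.
move=> w Gw Fw; apply/eqP/negP => /negP wv.
have /choice[u uP] (n : nat) : exists u : X, `|u| = 1 /\ `|u - dF u| <= n.+1%:R^-1.
  have n0 : 0 < n.+1%:R^-1 :> R by rewrite invr_gt0.
  have [x x1 xn] :=
    semidifferential_approx_fixpoint F_nonexp Gv Fv Gw Fw wv A1 n0.
  by exists x.
pose g x := x - dF x.
have gu : g \o u @ \oo --> (0 : X).
  apply: norm_cvg0.
  apply: (@squeeze_cvgr _ _ _ _ (fun=> 0) (@harmonic R)).
  - by near=> n; rewrite normr_ge0 /=; case: (uP n).
  - exact: cvg_cst.
  - exact: cvg_harmonic.
have ub : bounded_fun u.
  exists 1; split => // M M1 n _ /=; case: (uP n) => -> _; exact: ltW.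
have [phi phi_incr /cvg_ex[l ul]] := A2 u (fun=> I) ub gu.
have [_ dF_cont _ _] := A1.
have gl : g l = 0.
  (* Along the subsequence [g] tends to [g l] by continuity of [dF], and to 0 by the choice of
     [u]. *)
  have h1 : g \o (u \o phi) @ \oo --> (g l : X).
    apply: cvg_comp ul _.
    by apply: (@cvgB _ X X); [exact: cvg_id|exact: dF_cont].
  have h2 : (g \o u) \o phi @ \oo --> (0 : X).
    apply: cvg_comp gu => A [N _ NA]; exists N => // n /= Nn.
    apply: NA => /=; apply: leq_trans Nn _.
    (* A strictly increasing [phi] satisfies [n <= phi n]. *)
    elim: n => // n /leq_ltn_trans; apply.
    by move/increasing_seqP: phi_incr; exact.
  exact: cvg_unique h1 h2.
have l0 : l = 0 by apply: A3; apply/esym/eqP; rewrite -subr_eq0; apply/eqP.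
(* As a limit of unit vectors, [l] has norm 1, which contradicts [l = 0]. *)
have : (fun n => `|(u \o phi) n|) @ \oo --> `|l| by exact: cvg_norm.
have -> : (fun n => `|(u \o phi) n|) = (fun=> 1).
  by apply/funext => n /=; case: (uP (phi n)).
rewrite l0 normr0 => c10.
have : 1 = 0 :> R by apply: cvg_unique c10 => //; exact: cvg_cst.
by apply/eqP; rewrite oner_eq0.
Unshelve. all: by end_near.
Qed.
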